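(* For each positive integer $m$, the positive braid words $\sigma_1^{2m}(\sigma_2\sigma_1^2\sigma_2)^m$ and $(\sigma_2\sigma_1^2\sigma_2)^m\sigma_1^{2m}$ are equivalent, and the combinatorial distance between them equals $4m^2$.
   Context: For $n\ge 3$, the braid group $B_n$ is the group with generators $\sigma_1,\dots,\sigma_{n-1}$ and relations (called braid relations) $\sigma_i\sigma_j=\sigma_j\sigma_i$ for $|i-j|\ge 2$ and $\sigma_i\sigma_j\sigma_i=\sigma_j\sigma_i\sigma_j$ for $|i-j|=1$. A positive ($n$-strand) braid word is a finite sequence of letters $\sigma_i$, $1\le i\le n-1$ (no inverse letters); powers and products denote repetition and concatenation of words (no relation being applied). Applying one braid relation to a positive braid word means replacing one factor (block of consecutive letters) that is one side of a braid relation by the other side of that relation. Two positive braid words are equivalent if one can be transformed into the other by finitely many applications of braid relations. The combinatorial distance between two equivalent positive braid words is the minimal number of applications of braid relations needed to transform the first word into the second. *)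

(* Defs.v *)
From mathcomp Require Import all_boot all_order all_algebra.

Set Implicit Arguments.
Unset Strict Implicit.
Unset Printing Implicit Defensive.

Import IntDist.

(* The letters sigma_1, ..., sigma_(n-1): the index is the one written in the
   mathematics, starting from 1. *)
Definition letter (n : nat) : Type := {i : nat | 0 < i < n}.

Definition braid_word (n : nat) : Type := seq (letter n).

Fact sigma1_subproof (n : nat) (hn : 3 <= n) : 0 < 1 < n.
Proof. exact: ltnW hn. Qed.

Fact sigma2_subproof (n : nat) (hn : 3 <= n) : 0 < 2 < n.
Proof. exact: hn. Qed.

Definition sigma1 (n : nat) (hn : 3 <= n) : letter n :=
  exist (fun i => is_true (0 < i < n)) 1 (sigma1_subproof hn).

Definition sigma2 (n : nat) (hn : 3 <= n) : letter n :=
  exist (fun i => is_true (0 < i < n)) 2 (sigma2_subproof hn).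

Definition word_pow (n : nat) (w : braid_word n) (k : nat) : braid_word n :=
  flatten (nseq k w).

(* Both families are symmetric in i and j, so each relation is listed in both
   directions. *)
Inductive braid_relation (n : nat) : braid_word n -> braid_word n -> Prop :=
| Far_commutation (i j : letter n) :
    2 <= `|val i - val j| -> braid_relation [:: i; j] [:: j; i]
| Adjacent_braid (i j : letter n) :
    `|val i - val j| = 1 -> braid_relation [:: i; j; i] [:: j; i; j].

Inductive braid_step (n : nat) : braid_word n -> braid_word n -> Prop :=
| Braid_step (u v l r : braid_word n) :
    braid_relation l r -> braid_step (u ++ l ++ v) (u ++ r ++ v).

Inductive transforms_in (n : nat) : nat -> braid_word n -> braid_word n -> Prop :=
| Transforms_0 (w : braid_word n) : transforms_in 0 w w
| Transforms_S (k : nat) (w w' w'' : braid_word n) :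
    braid_step w w' -> transforms_in k w' w'' -> transforms_in k.+1 w w''.

Definition braid_equivalent (n : nat) (w w' : braid_word n) : Prop :=
  exists k : nat, transforms_in k w w'.

(* The combinatorial distance as a relation: d is the least number of steps.
   It never holds when the words are not equivalent. *)
Definition combinatorial_distance (n : nat) (w w' : braid_word n) (d : nat) :
    Prop :=
  transforms_in d w w' /\ forall k : nat, transforms_in k w w' -> d <= k.

(* Main.v *)
Require Import Defs.
From mathcomp Require Import all_boot all_order all_algebra.
From mathcomp Require Import zify.

Set Implicit Arguments.
Unset Strict Implicit.
Unset Printing Implicit Defensive.

(** A single letter sigma_1 moves across sigma_2 sigma_1^2 sigma_2 in two steps,
    [12112 -> 21212 -> 21121]. Moving each of the [2m] letters sigma_1 across
    each of the [m] blocks therefore takes [2m * m * 2 = 4m^2] steps.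

    For the lower bound, read a braid word as a diagram: number the strands by
    their starting positions and record, for each letter, the pair of strands
    that cross there ([crossings]). Applying a braid relation reverses a
    factor of this record, and inside that factor two given strands cross at
    most once. Let [precedences] count the pairs made of a crossing of strands
    1 and 2 followed, anywhere later, by a crossing of strands 1 and 3. Such a
    pair can only appear or disappear when both its crossings lie in the
    reversed factor, so one step changes the count by at most one
    ([precedences_step]). The first word starts with all [2m] crossings of
    strands 1 and 2, and its blocks contain the [2m] crossings of strands 1 and
    3; in the second word the order is the opposite. The count thus drops from
    [4m^2] to [0], which requires at least [4m^2] steps. *)

(** * Composing derivations, and the upper bound *)

Section Transforms.
Variable n : nat.
Implicit Types u v w x y : braid_word n.

Lemma transforms_in_trans j k u v w :
  transforms_in j u v -> transforms_in k v w -> transforms_in (j + k) u w.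
Proof.
elim=> // {}j {}u u' {}v step_u _ IH vw.
exact: Transforms_S step_u (IH vw).
Qed.

Lemma transforms_in_cat k u v w w' :
  transforms_in k w w' -> transforms_in k (u ++ w ++ v) (u ++ w' ++ v).
Proof.
elim=> [x|{}k x x' x'' [a b l r lr] _ IH]; first exact: Transforms_0.
apply: Transforms_S IH.
by have := Braid_step (u ++ a) (b ++ v) lr; rewrite -!catA.
Qed.

Lemma transforms_in_catl k u w w' :
  transforms_in k w w' -> transforms_in k (u ++ w) (u ++ w').
Proof. by move/(transforms_in_cat u [::]); rewrite !cats0. Qed.

Lemma transforms_in_catr k v w w' :
  transforms_in k w w' -> transforms_in k (w ++ v) (w' ++ v).
Proof. exact: transforms_in_cat [::] v w w'. Qed.

Lemma word_powS w k : word_pow w k.+1 = w ++ word_pow w k.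
Proof. by []. Qed.

(** Each of the [a] copies of [x] crosses [y] at a cost of [k] steps, starting
    with the copy that is next to [y]. *)
Lemma transforms_in_powl k x y a :
  transforms_in k (x ++ y) (y ++ x) ->
  transforms_in (a * k) (word_pow x a ++ y) (y ++ word_pow x a).
Proof.
move=> xy; elim: a => [|a IH]; first by rewrite cats0; exact: Transforms_0.
rewrite word_powS mulSnr -catA.
apply: transforms_in_trans (transforms_in_catl x IH) _.
by rewrite !catA; apply: transforms_in_catr.
Qed.

Lemma transforms_in_pow k x y a b :
  transforms_in k (x ++ y) (y ++ x) ->
  transforms_in (b * (a * k)) (word_pow x a ++ word_pow y b)
                              (word_pow y b ++ word_pow x a).
Proof.
move/(transforms_in_powl a) => xy.
elim: b => [|b IH]; first by rewrite cats0; exact: Transforms_0.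
rewrite word_powS mulSn catA.
apply: transforms_in_trans (transforms_in_catr _ xy) _.
by rewrite -!catA; apply: transforms_in_catl.
Qed.

End Transforms.

Lemma sigma1_across_block n (hn : 3 <= n) :
  let s1 := sigma1 hn in let s2 := sigma2 hn in
  transforms_in 2 [:: s1; s2; s1; s1; s2] [:: s2; s1; s1; s2; s1].
Proof.
move=> s1 s2.
have r12 : braid_relation [:: s1; s2; s1] [:: s2; s1; s2].
  exact: Adjacent_braid.
have r21 : braid_relation [:: s2; s1; s2] [:: s1; s2; s1].
  exact: Adjacent_braid.
apply: Transforms_S (Braid_step [::] [:: s1; s2] r12) _.
exact: Transforms_S (Braid_step [:: s2; s1] [::] r21) (Transforms_0 _).
Qed.

(** * Ordered pairs of events in a sequence *)

Section Precedences.
Variables (T : Type) (P Q : pred T).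
Implicit Types s t : seq T.

(** An inversion number: it measures how far the [P]-events of a sequence are
    from all coming after its [Q]-events. *)
Fixpoint precedences s : nat :=
  if s is x :: t then P x * count Q t + precedences t else 0.

Lemma precedences_cat s t :
  precedences (s ++ t) = precedences s + count P s * count Q t + precedences t.
Proof. elim: s => //= x s ->; rewrite count_cat; lia. Qed.

Lemma leq_precedences s : precedences s <= count P s * count Q s.
Proof. by elim: s => //= x s IH; nia. Qed.

(** Only the pairs internal to the replaced factor [s] are affected when it is
    replaced by a factor [t] with the same contents. *)
Lemma leq_precedences_replace u s t v :
    count P s = count P t -> count Q s = count Q t ->
    count P s <= 1 -> count Q s <= 1 ->
  precedences (u ++ s ++ v) <= precedences (u ++ t ++ v) + 1.
Proof.
move=> eqP eqQ P1 Q1; rewrite !precedences_cat !count_cat eqP eqQ.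
have := leq_precedences s; nia.
Qed.

End Precedences.

(** * The strands that cross at each letter *)

Definition transp (i k : nat) : nat :=
  if k == i then i.+1 else if k == i.+1 then i else k.

Lemma transp_inj i : injective (transp i).
Proof. by move=> j k; rewrite /transp; do ?case: ifP; lia. Qed.

Section Crossings.
Variable n : nat.
Implicit Types (s : nat -> nat) (u v w : braid_word n).

(** An arrangement [s] gives the strand [s k] found at position [k]. Letters
    act by composition on the right because they exchange positions, whatever
    strands stand there. *)
Definition arrange s w : nat -> nat :=
  foldl (fun s i => s \o transp (val i)) s w.

(** Keeping the strand that comes from the left first in each pair makes a
    braid relation an exact reversal of the record. *)
Fixpoint crossings s w : seq (nat * nat) :=
  if w is i :: w' then
    (s (val i), s (val i).+1) :: crossings (s \o transp (val i)) w'
  else [::].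

Lemma crossings_ext s s' w : s =1 s' -> crossings s w = crossings s' w.
Proof.
elim: w s s' => //= i w IH s s' ss'; rewrite !ss'; congr cons.
by apply: IH => k /=.
Qed.

Lemma crossings_cat s u v :
  crossings s (u ++ v) = crossings s u ++ crossings (arrange s u) v.
Proof. by elim: u s => //= i u IH s; rewrite IH. Qed.

Lemma arrange_ext s s' w : s =1 s' -> arrange s w =1 arrange s' w.
Proof. by elim: w s s' => //= i w IH s s' ss'; apply: IH => k /=. Qed.

Lemma arrange_cat s u v : arrange s (u ++ v) = arrange (arrange s u) v.
Proof. exact: foldl_cat. Qed.

Lemma arrange_inj s w : injective s -> injective (arrange s w).
Proof.
elim: w s => //= i w IH s inj_s.
by apply: IH; apply: inj_comp inj_s (@transp_inj _).
Qed.

Lemma arrange_relation s l r : braid_relation l r -> arrange s l =1 arrange s r.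
Proof.
by case=> -[i ?] [j ?] /= ij k; congr s; rewrite /transp; do ?case: ifP; lia.
Qed.

(** Both orders are accepted: strands that cross twice in a row are recorded in
    opposite orders. *)
Definition joins (a b : nat) (x : nat * nat) : bool :=
  (x.1 == a) && (x.2 == b) || (x.1 == b) && (x.2 == a).

(** For a relation 121 = 212 on strands p, q, r this is the passage from the
    record pq, pr, qr to the record qr, pr, pq. *)
Lemma crossings_relation s l r :
  braid_relation l r -> crossings s r = rev (crossings s l).
Proof.
case=> -[i ?] [j ?] /= ij; rewrite /rev /=.
  by congr [:: (s _, s _); (s _, s _)]; rewrite /transp; do ?case: ifP; lia.
by congr [:: (s _, s _); (s _, s _); (s _, s _)];
  rewrite /transp; do ?case: ifP; lia.
Qed.

Lemma joins_excl a b p q r t :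
  p \notin [:: r; t] \/ q \notin [:: r; t] ->
  joins a b (p, q) + joins a b (r, t) <= 1.
Proof. by rewrite /joins !inE /=; lia. Qed.

(** The sides of the braid relations are reduced words: no two strands cross
    twice in their diagrams. *)
Lemma count_joins_relation s l r a b :
  injective s -> braid_relation l r -> count (joins a b) (crossings s l) <= 1.
Proof.
move=> inj_s.
have excl i j k h : i \notin [:: k; h] \/ j \notin [:: k; h] ->
    joins a b (s i, s j) + joins a b (s k, s h) <= 1.
  by move=> dis; apply: joins_excl; move: dis; rewrite !inE !(inj_eq inj_s).
case=> -[i ?] [j ?] /= ij.
  have [-> ->] : transp i j = j /\ transp i j.+1 = j.+1.
    by rewrite /transp; do ?case: ifP; lia.
  by rewrite addn0 excl // !inE; lia.
have [-> ->] : transp i (transp j i) = j /\ transp i (transp j i.+1) = j.+1.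
  by rewrite /transp; do ?case: ifP; lia.
have [def_j | def_i] : j = i.+1 \/ i = j.+1 by lia.
  have [-> ->] : transp i j = i /\ transp i j.+1 = j.+1.
    by rewrite /transp; do ?case: ifP; lia.
  have := excl i i.+1 i j.+1; have := excl i i.+1 j j.+1.
  have := excl i j.+1 j j.+1; rewrite def_j !inE; lia.
have [-> ->] : transp i j = j /\ transp i j.+1 = i.+1.
  by rewrite /transp; do ?case: ifP; lia.
have := excl i i.+1 j i.+1; have := excl i i.+1 j j.+1.
have := excl j i.+1 j j.+1; rewrite def_i !inE; lia.
Qed.

(** The replaced factor is reversed, which keeps its contents, and each of the
    two pairs of strands crosses at most once in it; what follows the factor
    sees the same arrangement of strands before and after the step. *)
Lemma precedences_step s a b c d w w' :
    injective s -> braid_step w w' ->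
  precedences (joins a b) (joins c d) (crossings s w) <=
  precedences (joins a b) (joins c d) (crossings s w') + 1.
Proof.
move=> inj_s [u v l r lr]; rewrite !crossings_cat.
rewrite (crossings_ext v (arrange_relation (arrange s u) lr)).
have inj_su := arrange_inj (w := u) inj_s.
by apply: leq_precedences_replace;
  rewrite ?(count_joins_relation _ _ inj_su lr) // (crossings_relation _ lr)
          count_rev.
Qed.

Lemma precedences_transforms s a b c d k w w' :
    injective s -> transforms_in k w w' ->
  precedences (joins a b) (joins c d) (crossings s w) <=
  precedences (joins a b) (joins c d) (crossings s w') + k.
Proof.
move=> inj_s; elim=> [x|{}k x x' x'' step_x _ IH]; first by rewrite addn0.
have := precedences_step a b c d inj_s step_x; lia.
Qed.

Lemma arrange_pow s x k : arrange s x =1 s -> arrange s (word_pow x k) =1 s.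
Proof.
move=> pure_x; elim: k => // k IH i.
by rewrite word_powS arrange_cat (arrange_ext _ pure_x) IH.
Qed.

Lemma count_crossings_pow (P : pred (nat * nat)) s x k :
  arrange s x =1 s ->
  count P (crossings s (word_pow x k)) = k * count P (crossings s x).
Proof.
move=> pure_x; elim: k => // k IH.
by rewrite word_powS crossings_cat (crossings_ext _ pure_x) count_cat IH mulSn.
Qed.

End Crossings.

Lemma word_powM n (w : braid_word n) j k :
  word_pow w (j * k) = word_pow (word_pow w j) k.
Proof.
have powD a b : word_pow w (a + b) = word_pow w a ++ word_pow w b.
  by rewrite /word_pow nseqD flatten_cat.
elim: k => [|k IH]; first by rewrite muln0.
by rewrite mulnS powD IH.
Qed.

(** * The distance *)

Theorem proposition1 (n : nat) (hn : 3 <= n) (m : nat) (hm : 0 < m) :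
  let s1 : braid_word n := [:: sigma1 hn] in
  let s2 : braid_word n := [:: sigma2 hn] in
  let w : braid_word n :=
    word_pow s1 (2 * m) ++ word_pow (s2 ++ word_pow s1 2 ++ s2) m in
  let w' : braid_word n :=
    word_pow (s2 ++ word_pow s1 2 ++ s2) m ++ word_pow s1 (2 * m) in
  braid_equivalent w w' /\ combinatorial_distance w w' (4 * m ^ 2).
Proof.
move=> s1 s2 w w'.
have ww' : transforms_in (4 * m ^ 2) w w'.
  have -> : 4 * m ^ 2 = m * (2 * m * 2) by lia.
  exact: (@transforms_in_pow n 2 s1 (s2 ++ word_pow s1 2 ++ s2) _ _
            (sigma1_across_block hn)).
split; first by exists (4 * m ^ 2).
split=> // k /(precedences_transforms 1 2 1 3 (@inj_id nat)).
rewrite /w /w' word_powM; set x := word_pow s1 2; set y := s2 ++ x ++ s2.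
(* Both blocks are pure braids, so every repetition of a block has the same
   crossings as the first one. *)
have pure_x : arrange id x =1 id by case=> [|[|[|]]].
have pure_y : arrange id y =1 id by case=> [|[|[|[|]]]].
have pure_xm := arrange_pow m pure_x.
have pure_ym := arrange_pow m pure_y.
rewrite !crossings_cat (crossings_ext _ pure_xm) (crossings_ext _ pure_ym).
have x12 := count_crossings_pow (joins 1 2) m pure_x.
have x13 := count_crossings_pow (joins 1 3) m pure_x.
have y12 := count_crossings_pow (joins 1 2) m pure_y.
have y13 := count_crossings_pow (joins 1 3) m pure_y.
have := leq_precedences (joins 1 2) (joins 1 3) (crossings id (word_pow x m)).
have := leq_precedences (joins 1 2) (joins 1 3) (crossings id (word_pow y m)).
rewrite !precedences_cat x12 x13 y12 y13 /=; nia.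
Qed.
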